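(* Fix an integer $q\ge2$ and $\beta>0$. For all constants $\Delta$ and $C$ there is a constant $K=K(\Delta,C,q,\beta)$ such that the following holds. Let $G=(V,\mathbb{E})$ be any finite bipartite graph of maximum degree at most $\Delta$ with $n=|V|\ge2$ vertices. If the Gibbs distribution $\mu=\mu_{G,\beta}$ of the $q$-state Potts model on $G$ satisfies approximate even/odd factorization with constant $C$, then the mixing time of the Swendsen-Wang dynamics on $G$ satisfies $T_{\rm mix}(SW)\le K\log n$.
   Context: **Potts model.** For a finite graph $G=(V,\mathbb{E})$ let $\Omega=\{1,\dots,q\}^V$; for $\sigma\in\Omega$ let $D(\sigma)=\{\{v,w\}\in\mathbb{E}:\sigma_v\ne\sigma_w\}$, $M(\sigma)=\mathbb{E}\setminus D(\sigma)$, and $\mu(\sigma)=\frac1Z e^{-\beta|D(\sigma)|}$ with $Z=\sum_{\sigma\in\Omega}e^{-\beta|D(\sigma)|}$. **Entropy.** For $f:\Omega\to\mathbb{R}_+$, $\mu[f]=\sum_\sigma\mu(\sigma)f(\sigma)$ and $\mathrm{Ent}_\mu(f)=\mu[f\log(f/\mu[f])]$ (with $0\log 0=0$). **Approximate even/odd factorization.** For a bipartite graph with bipartition $V=E\sqcup O$ (even and odd sides), let $\sigma_E,\sigma_O$ be the restrictions of $\sigma$ to $E$, $O$. Let $\mathrm{Ent}_\mu(f\mid\sigma_E)$ be the entropy of $f$ with respect to $\mu(\cdot\mid\sigma_E)$ (the Gibbs measure conditioned on the spins on $E$), and similarly $\mathrm{Ent}_\mu(f\mid\sigma_O)$. Approximate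 even/odd factorization with constant $C$ holds if for all $f:\Omega\to\mathbb{R}_+$, $$\mathrm{Ent}_\mu(f)\le C\big(\mu[\mathrm{Ent}_\mu(f\mid\sigma_E)]+\mu[\mathrm{Ent}_\mu(f\mid\sigma_O)]\big).$$ **Swendsen-Wang (SW) dynamics.** The Markov chain on $\Omega$ which, from $\sigma(t)$: (1) independently keeps each edge of $M(\sigma(t))$ with probability $1-e^{-\beta}$, giving $A(t)\subseteq M(\sigma(t))$; (2) for each connected component of $(V,A(t))$ independently chooses a uniformly random spin in $\{1,\dots,q\}$ and assigns it to all vertices of the component, giving $\sigma(t+1)$. It is reversible with respect to $\mu$. **Mixing time.** For an ergodic chain $P$ on a finite state space $\Gamma$ with stationary distribution $\pi$, $T_{\rm mix}(P)=\max_{x\in\Gamma}\min\{t\ge0:\|P^t(x,\cdot)-\pi\|_{TV}\le 1/4\}$, with $\|\cdot\|_{TV}$ total variation distance. *)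

(* Defs.v *)
From HB Require Import structures.
From mathcomp Require Import all_boot all_order all_algebra.
From mathcomp Require Import all_classical all_reals all_analysis.

Set Implicit Arguments.
Unset Strict Implicit.
Unset Printing Implicit Defensive.

Import Order.TTheory GRing.Theory Num.Theory.
Local Open Scope ring_scope.

Section Graph.
Variables (V : finType) (e : rel V).

(* An edge is an unordered pair, encoded as the set of its two endpoints. *)
Definition edges : {set {set V}} :=
  [set [set p.1; p.2]%SET | p : V * V & e p.1 p.2].

Definition simple_graph := symmetric e /\ irreflexive e.

Definition max_degree_le (Delta : nat) :=
  forall v, (#|[set w | e v w]%SET| <= Delta)%N.

Definition bipartition (E O : {set V}) :=
  [/\ E :|: O = [set: V]%SET, [disjoint E & O]
    & forall v w, e v w -> (v \in E) && (w \in O) || (v \in O) && (w \in E)].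

Definition components (A : {set {set V}}) : {set {set V}} :=
  equivalence_partition (connect [rel v w | [set v; w]%SET \in A])
    [set: V]%SET.

End Graph.

Section FiniteChains.
Variables (R : realType) (T : finType).

Definition expect (nu f : T -> R) : R := \sum_s nu s * f s.

(* [ln] vanishes outside the positive reals, so that 0 log 0 = 0. *)
Definition Ent (nu f : T -> R) : R :=
  expect nu (fun s => f s * ln (f s / expect nu f)).

Definition dTV (nu nu' : T -> R) : R := 2^-1 * \sum_x `|nu x - nu' x|.

Fixpoint kernel_pow (P : T -> T -> R) (t : nat) (x y : T) : R :=
  if t is t'.+1 then \sum_z kernel_pow P t' x z * P z y else (x == y)%:R.

(* The infimum over a nonempty set of times is a minimum; it is +oo if the    *)
(* chain started at x never gets 1/4-close to pi.                             *)
Definition Tmix (P : T -> T -> R) (pi : T -> R) : \bar R :=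
  \big[maxe/-oo%E]_(x : T)
    ereal_inf [set (t%:R)%:E | t in
      [set t : nat | dTV (kernel_pow P t x) pi <= 4^-1]%classic]%classic.

End FiniteChains.

Section Potts.
Variables (R : realType) (V : finType) (e : rel V) (q : nat) (beta : R).

Local Notation config := {ffun V -> 'I_q}.

Definition bichromatic (s : config) : {set {set V}} :=
  [set [set p.1; p.2]%SET | p : V * V & e p.1 p.2 && (s p.1 != s p.2)].

Definition monochromatic (s : config) : {set {set V}} :=
  edges e :\: bichromatic s.

Definition potts_weight (s : config) : R :=
  expR (- beta * #|bichromatic s|%:R).

Definition potts_Z : R := \sum_(s : config) potts_weight s.

Definition potts (s : config) : R := potts_weight s / potts_Z.

Definition agree (A : {set V}) (s t : config) : bool :=
  [forall v in A, t v == s v].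

Definition potts_cond (A : {set V}) (s : config) (t : config) : R :=
  if agree A s t then potts t / \sum_(u | agree A s u) potts u else 0.

Definition even_odd_factorization (E O : {set V}) (C : R) :=
  forall f : config -> R, (forall s, 0 <= f s) ->
  Ent potts f <= C * (expect potts (fun s => Ent (potts_cond E s) f)
                    + expect potts (fun s => Ent (potts_cond O s) f)).

Definition percolation (M A : {set {set V}}) : R :=
  if A \subset M then
    \prod_(x in M) (if x \in A then 1 - expR (- beta) else expR (- beta))
  else 0.

(* The components choose independent uniform spins: the factor at B is the    *)
(* probability that a uniform spin a is the value of t at every vertex of B.  *)
Definition recolor (A : {set {set V}}) (t : config) : R :=
  \prod_(B in components A)
    (#|[set a : 'I_q | [forall v in B, t v == a]]%SET|%:R / q%:R).

Definition SW (s t : config) : R :=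
  \sum_(A : {set {set V}}) percolation (monochromatic s) A * recolor A t.

End Potts.

Arguments potts {R V} e q beta s.
Arguments SW {R V} e q beta s t.
Arguments even_odd_factorization {R V} e q beta E O C.

(* Main.v *)
Require Import Defs.
From HB Require Import structures.
From mathcomp Require Import all_boot all_order all_algebra.
From mathcomp Require Import all_classical all_reals all_analysis.
From mathcomp Require Import ring lra.

Set Implicit Arguments.
Unset Strict Implicit.
Unset Printing Implicit Defensive.

Import Order.TTheory GRing.Theory Num.Theory.
Local Open Scope ring_scope.

(* Let m be a positive law, m' its image under one Swendsen-Wang step, and    *)
(* H(A) the relative entropy of the marginals of m and mu on the spins in A.  *)
(* Percolation on M(sigma) is M(sigma) :&: W for a Bernoulli edge set W       *)
(* independent of sigma.  Given W, the new configuration depends on sigma     *)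
(* only through the spins on E :|: S, where S is the random set of odd        *)
(* vertices touched by W; hence KL(m' | mu) <= E[H(E :|: S)] by data          *)
(* processing and stationarity of mu.  Given the even spins, mu is a product  *)
(* over the odd vertices, so A |-> H(E :|: A) is supermodular on subsets of   *)
(* O; as P(v \in S) <= 1 - eps with eps = exp(- beta * Delta), this gives     *)
(*   KL(m' | mu) <= KL(m | mu) - eps * (KL(m | mu) - H(E)).                   *)
(* The last difference is mu[Ent(f | sigma_E)] for f = m / mu.  Averaging     *)
(* with the same bound for O and using the factorization, the relative        *)
(* entropy contracts by a constant factor at each step.  It is O(n) after the *)
(* first step, and small relative entropy implies small total variation.      *)

(** [SW_bernoulli] decouples percolation from the spins, and by [monochromatic_touched] only the
    spins on E and on the touched odd vertices matter; [mixture_dpi] turns this into an average of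
    marginal relative entropies. Supermodularity ([KL_marg_supermodular]) is strong subadditivity of
    the Shannon entropy of m: the contribution of mu to the increment at an odd v is the same for
    every set [E :|: T] with v outside T. [supermodular_average] combines it with the one-vertex
    bounds of [bernoulli_touched] into [KL_step].

    The chain rule [Ent_cond_density] connects this with the factorization and yields
    [KL_contraction], whose rate does not depend on n. Since the entropy after one step is at most
    linear in n ([KL_le]), O(log n) further steps bring it below 1/16, where [kl_dTV] applies. *)

Section RelativeEntropy.
Variable R : realType.

Lemma ln_le_subr1 (x : R) : 0 < x -> ln x <= x - 1.
Proof.
by move=> x0; have := @le_ln1Dx R (x - 1); rewrite subrKC; apply; lra.
Qed.

(** Averaging [ln x <= x - 1] against weights that need not sum to 1; the entropy inequalities of
    this section all reduce to it. *)
Lemma gibbs (I : finType) (w x : I -> R) :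
  (forall i, 0 <= w i) -> (forall i, 0 < x i) ->
  \sum_i w i * x i <= \sum_i w i -> \sum_i w i * ln (x i) <= 0.
Proof.
move=> w0 x0 le; apply: (@le_trans _ _ (\sum_i (w i * x i - w i))).
  apply: ler_sum => i _; rewrite -[X in _ - X]mulr1 -mulrBr.
  by rewrite ler_wpM2l // ln_le_subr1.
by rewrite sumrB subr_le0.
Qed.

Variable T : finType.
Implicit Types (r : rel T) (m : T -> R).

Definition marg r m (t : T) : R := \sum_(u | r t u) m u.

Lemma marg_gt0 r m t : equivalence_rel r -> (forall s, 0 < m s) ->
  0 < marg r m t.
Proof.
move=> er m0; rewrite /marg (bigD1 t) /=; last by have [] := er t t t.
by rewrite ltr_pwDl // sumr_ge0 // => s _; exact/ltW.
Qed.

Lemma equiv_sym r s t : equivalence_rel r -> r s t = r t s.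
Proof.
move=> er; apply/idP/idP => h.
  by rewrite -(er s t s).2 // (er s s s).1.
by rewrite -(er t s t).2 // (er t t t).1.
Qed.

Lemma marg_equiv r m s t : equivalence_rel r -> r s t ->
  marg r m s = marg r m t.
Proof. by move=> er st; apply: eq_bigl => u; rewrite (er s t u).2. Qed.

(* Both marginals are constant on a class of [r], where [a] sums to its own   *)
(* marginal.                                                                  *)
Lemma sum_marg_exchange r (a b F : T -> R) : equivalence_rel r ->
  (forall s, 0 < a s) -> (forall s t, r s t -> F s = F t) ->
  \sum_t a t * (marg r b t / marg r a t) * F t = \sum_t b t * F t.
Proof.
move=> er a0 HF.
transitivity (\sum_t \sum_(u | r t u) a t / marg r a u * (b u * F u)).
  apply: eq_bigr => t _.
  transitivity (\sum_(u | r t u) b u * (a t / marg r a t * F t)).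
    by rewrite -mulr_suml -/(marg r b t); ring.
  apply: eq_bigr => u rtu.
  by rewrite (marg_equiv _ er rtu) (HF _ _ rtu); ring.
rewrite (exchange_big_dep xpredT) //=; apply: eq_bigr => u _.
rewrite -mulr_suml -mulr_suml.
under eq_bigl => t do rewrite equiv_sym //.
by rewrite -/(marg r a u) divff ?mul1r // gt_eqF // marg_gt0.
Qed.

(** Nonnegativity of the conditional mutual information of the r1-class and the r2-class given the
    r0-class, both being finer than r0. *)
Lemma shannon_strong_subadditivity r0 r1 r2 r12 m :
  equivalence_rel r0 -> equivalence_rel r1 -> equivalence_rel r2 ->
  equivalence_rel r12 -> subrel r1 r0 -> subrel r2 r0 ->
  (forall s t, r12 s t = r1 s t && r2 s t) -> (forall s, 0 < m s) ->
  \sum_t m t * (ln (marg r1 m t) + ln (marg r2 m t)) <=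
  \sum_t m t * (ln (marg r0 m t) + ln (marg r12 m t)).
Proof.
move=> e0 e1 e2 e12 s1 s2 h12 m0.
have P r t : equivalence_rel r -> 0 < marg r m t by move=> er; apply: marg_gt0.
rewrite -subr_le0 -sumrB.
under eq_bigr => t _.
  have -> : m t * (ln (marg r1 m t) + ln (marg r2 m t)) -
     m t * (ln (marg r0 m t) + ln (marg r12 m t)) =
     m t * ln ((marg r1 m t * marg r2 m t) / (marg r0 m t * marg r12 m t)).
    by rewrite ln_div ?lnM ?posrE ?mulr_gt0 ?P // -mulrBr.
  over.
apply: gibbs => [t|t|]; first exact/ltW.
  by rewrite divr_gt0 // mulr_gt0 ?P.
(* Comparison with the law of a pair (u, w) drawn conditionally independently given the r0-class;
   its total mass is that of m. *)
apply: (@le_trans _ _ (\sum_u \sum_(w | r0 u w) m u * m w / marg r0 m u));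
  last first.
  apply: ler_sum => u _; rewrite -mulr_suml -mulr_sumr -/(marg r0 m u).
  by rewrite mulfK // gt_eqF // P.
have -> : \sum_t m t * (marg r1 m t * marg r2 m t / (marg r0 m t * marg r12 m t))
  = \sum_u \sum_w \sum_(t | r1 t u && r2 t w)
      m u * m w / marg r0 m u * (m t / marg r12 m t).
  transitivity (\sum_t \sum_(u | r1 t u) \sum_(w | r2 t w)
      m u * m w / marg r0 m u * (m t / marg r12 m t)).
    apply: eq_bigr => t _.
    transitivity (\sum_(u | r1 t u) m u * (m t * marg r2 m t / (marg r0 m t * marg r12 m t))).
      by rewrite -mulr_suml -/(marg r1 m t) !mulrA [m t * _]mulrC.
    apply: eq_bigr => u tu; rewrite -(marg_equiv _ e0 (s1 _ _ tu)).
    transitivity (\sum_(w | r2 t w) m w * (m u / marg r0 m t * (m t / marg r12 m t))).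
      by rewrite -mulr_suml -/(marg r2 m t) invfM; ring.
    by apply: eq_bigr => w _; ring.
  rewrite (exchange_big_dep xpredT) //=; apply: eq_bigr => u _.
  by rewrite (exchange_big_dep xpredT).
apply: ler_sum => u _; rewrite [leRHS]big_mkcond /=; apply: ler_sum => w _.
rewrite -mulr_sumr.
(* Either the classes of u and w meet, in a single r12-class whose normalized mass is 1, or the left
   side vanishes. *)
have [t /andP[tu tw]|no] := pickP (fun t => r1 t u && r2 t w); last first.
  rewrite big_pred0 // mulr0; case: ifP => // _.
  by rewrite divr_ge0 ?mulr_ge0 ?(ltW (m0 _)) // ltW // P.
have -> : r0 u w by rewrite -(e0 t u w).2; [exact: s2|exact: s1].
have -> : \sum_(i | r1 i u && r2 i w) m i / marg r12 m i = 1.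
  transitivity (\sum_(i | r12 t i) m i / marg r12 m t).
    apply: eq_big => [i|i /andP[iu iw]].
      by rewrite h12 -!(equiv_sym i) // (equiv_sym i u) // -(e1 t u i).2 //
         (equiv_sym i w) // -(e2 t w i).2 // equiv_sym // [r2 t i]equiv_sym.
    rewrite (@marg_equiv r12 m i t) // h12 (e1 i u t).2 // (e2 i w t).2 //.
    by rewrite equiv_sym // tu equiv_sym.
  by rewrite -mulr_suml -/(marg r12 m t) divff // gt_eqF // P.
by rewrite mulr1.
Qed.

(* [marg r m t] is the mass of the class of [t], so that this is the relative *)
(* entropy of the laws induced by [m] and [mu] on the classes of [r].         *)
Definition KL_marg (mu m : T -> R) r : R :=
  \sum_t m t * ln (marg r m t / marg r mu t).

Lemma KL_marg_mono mu m r r' : equivalence_rel r -> equivalence_rel r' ->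
  subrel r' r -> (forall s, 0 < m s) -> (forall s, 0 < mu s) ->
  KL_marg mu m r <= KL_marg mu m r'.
Proof.
move=> e e' sub m0 u0.
have P a r1 t : (forall s, 0 < a s) -> equivalence_rel r1 -> 0 < marg r1 a t.
  by move=> *; apply: marg_gt0.
rewrite -subr_le0 /KL_marg -sumrB.
under eq_bigr => t _.
  have -> : m t * ln (marg r m t / marg r mu t) -
      m t * ln (marg r' m t / marg r' mu t) =
     m t * ln ((marg r' mu t / marg r' m t) * (marg r m t / marg r mu t)).
    by rewrite [ln (_ * (_ / _))]lnM ?posrE ?divr_gt0 ?P // !ln_div ?posrE ?P //; ring.
  over.
apply: gibbs => [t|t|]; first exact/ltW.
  by rewrite mulr_gt0 ?divr_gt0 ?P.
under eq_bigr => t _ do rewrite mulrA.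
(* A first exchange replaces m by mu, a second one replaces mu by m; what remains is the total mass
   of m. *)
rewrite sum_marg_exchange //; last first.
  by move=> s t /sub st; rewrite !(@marg_equiv _ _ s t).
suff -> : \sum_t mu t * (marg r m t / marg r mu t) = \sum_t m t by [].
transitivity (\sum_t mu t * (marg r m t / marg r mu t) * 1).
  by apply: eq_bigr => t _; rewrite mulr1.
rewrite sum_marg_exchange //.
by apply: eq_bigr => t _; rewrite mulr1.
Qed.

(* [Q s i t]: draw [i] with probability [p i], then pass from [s] to [t];     *)
(* [Q s i t] only depends on the class of [s] for [r i], so that the data     *)
(* processing inequality applies after revealing [i].                         *)
Lemma mixture_dpi (I : finType) (p : I -> R) (r : I -> rel T)
    (Q : T -> I -> T -> R) (mu m m' : T -> R) :
  (forall i, equivalence_rel (r i)) ->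
  (forall s i t, 0 <= Q s i t) ->
  (forall i t s s', r i s s' -> Q s i t = Q s' i t) ->
  (forall s i, \sum_t Q s i t = p i) ->
  (forall s, 0 < m s) -> (forall s, 0 < mu s) -> (forall s, 0 < m' s) ->
  (forall t, m' t = \sum_s m s * \sum_i Q s i t) ->
  (forall t, mu t = \sum_s mu s * \sum_i Q s i t) ->
  \sum_t m' t * ln (m' t / mu t) <= \sum_i p i * KL_marg mu m (r i).
Proof.
move=> e Q0 Qr Qp m0 u0 m'0 m'E muE.
have P a i t : (forall s, 0 < a s) -> 0 < marg (r i) a t.
  by move=> *; apply: marg_gt0.
have eqL : \sum_t m' t * ln (m' t / mu t) =
    \sum_(x : T * I * T) m x.1.1 * Q x.1.1 x.1.2 x.2 * ln (m' x.2 / mu x.2).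
  rewrite -(pair_bigA _ (fun si t => m si.1 * Q si.1 si.2 t * ln (m' t / mu t))) /=.
  rewrite exchange_big /=; apply: eq_bigr => t _.
  rewrite {1}m'E -mulr_suml; congr (_ * _).
  rewrite -(pair_bigA _ (fun s i => m s * Q s i t)) /=.
  by apply: eq_bigr => s _; rewrite mulr_sumr.
have eqR : \sum_i p i * KL_marg mu m (r i) =
    \sum_(x : T * I * T) m x.1.1 * Q x.1.1 x.1.2 x.2 *
      ln (marg (r x.1.2) m x.1.1 / marg (r x.1.2) mu x.1.1).
  rewrite -(pair_bigA _ (fun si t => m si.1 * Q si.1 si.2 t *
     ln (marg (r si.2) m si.1 / marg (r si.2) mu si.1))) /=.
  rewrite -(pair_bigA _ (fun s i => \sum_t m s * Q s i t *
     ln (marg (r i) m s / marg (r i) mu s))) /=.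
  rewrite exchange_big /=; apply: eq_bigr => i _.
  rewrite mulr_sumr; apply: eq_bigr => s _.
  by rewrite -mulr_suml -mulr_sumr Qp; ring.
rewrite eqL eqR -subr_le0 -sumrB.
under eq_bigr => x _.
  rewrite -mulrBr -ln_div ?posrE ?divr_gt0 ?P //.
  over.
apply: gibbs => [x|x|]; first by rewrite mulr_ge0 // ltW.
  by rewrite !divr_gt0 ?P.
have -> : \sum_(x : T * I * T) m x.1.1 * Q x.1.1 x.1.2 x.2 = \sum_t m' t.
  rewrite -(pair_bigA _ (fun si t => m si.1 * Q si.1 si.2 t)) /=.
  rewrite exchange_big /=; apply: eq_bigr => t _.
  rewrite m'E -(pair_bigA _ (fun s i => m s * Q s i t)) /=.
  by apply: eq_bigr => s _; rewrite mulr_sumr.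
rewrite -(pair_bigA _ (fun si t => m si.1 * Q si.1 si.2 t * (m' t / mu t /
  (marg (r si.2) m si.1 / marg (r si.2) mu si.1)))) /=.
rewrite exchange_big /=; apply: ler_sum => t _.
rewrite -(pair_bigA _ (fun s i => m s * Q s i t * (m' t / mu t /
  (marg (r i) m s / marg (r i) mu s)))) /= exchange_big /=.
have mE : m' t = \sum_i \sum_s mu s * (Q s i t * (m' t / mu t)).
  rewrite exchange_big /=.
  under eq_bigr => s _ do rewrite -mulr_sumr -mulr_suml mulrA.
  by rewrite -mulr_suml -muE mulrC divfK // gt_eqF.
(* [mE] used that mu is stationary. As Q is constant on the classes of [r i], mu may be traded for m
   times the ratio of their marginals. *)
rewrite [leRHS]mE; apply: ler_sum => i _; rewrite -(@sum_marg_exchange (r i) m) //.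
  apply: ler_sum => s _; rewrite invf_div; rewrite le_eqVlt; apply/orP; left.
  by apply/eqP; ring.
by move=> s s' /(Qr _ t) ->.
Qed.

End RelativeEntropy.

(** * Averages of supermodular functions, and total variation from entropy *)

(** Add the vertices of U one at a time: by supermodularity the increment at v over the random set
    is at most the increment over all earlier vertices, and it is paid with probability at most
    theta. *)
Lemma supermodular_average (R : realType) (I V : finType) (p : I -> R)
    (S : I -> {set V}) (h : {set V} -> R) (theta : R) (U : {set V}) :
  (forall i, 0 <= p i) -> \sum_i p i = 1 ->
  (forall v, v \in U -> \sum_(i | v \in S i) p i <= theta) ->
  (forall A v, v \in U -> h A <= h (v |: A)%SET) ->
  (forall (A B : {set V}) v, A \subset B -> v \in U -> v \notin B ->
     h (v |: A)%SET - h A <= h (v |: B)%SET - h B) ->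
  \sum_i p i * h (S i :&: U) <= h (finset.set0) + theta * (h U - h (finset.set0)).
Proof.
move=> p0 p1 pS hm hs.
suff H (W : {set V}) : W \subset U ->
    \sum_i p i * h (S i :&: W) <= h (finset.set0) + theta * (h W - h (finset.set0)).
  exact: H.
have [n] := ubnP #|W|; elim: n W => // n IH W /ltnSE Wn WU.
have [->|[v vW]] := set_0Vmem W.
  rewrite subrr mulr0 addr0.
  by under eq_bigr do rewrite finset.setI0; rewrite -mulr_suml p1 mul1r.
have vU := fintype.subsetP WU v vW.
have v' : v \notin (W :\ v)%SET by rewrite !inE eqxx.
have lt : (#|(W :\ v)%SET| < n)%N by move: Wn; rewrite (cardsD1 v) vW.
have IHv := IH _ lt (fintype.subset_trans (finset.subsetDl _ _) WU).
move: lt IHv v'; have /esym := finset.setD1K vW; move: (W :\ v)%SET => W' WE _ IHv v'.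
set d := h W - h W'.
have d0 : 0 <= d by rewrite subr_ge0 WE hm.
apply: (@le_trans _ _ (\sum_i p i * h (S i :&: W') + theta * d)).
  apply: (@le_trans _ _
    (\sum_i p i * h (S i :&: W') + (\sum_(i | v \in S i) p i) * d)).
    rewrite mulr_suml [X in _ + X]big_mkcond -big_split /=; apply: ler_sum => i _.
    case: ifP => vi.
      rewrite -mulrDr ler_wpM2l // -lerBlDl /d WE.
      have -> : (S i :&: (v |: W') = v |: (S i :&: W'))%SET.
        by rewrite finset.setIUr (finset.setIidPr _) // finset.sub1set.
      by apply: hs => //; apply: finset.subsetIr.
    rewrite addr0 WE finset.setIUr.
    suff -> : S i :&: [set v]%SET = finset.set0 by rewrite finset.set0U.
    by apply/setP => w; rewrite !inE; case: eqP => [->|]; rewrite ?vi ?andbF.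
  by rewrite lerD2l ler_wpM2r // pS.
by rewrite /d; nra.
Qed.

Lemma kl_dTV (R : realType) (T : finType) (m u : T -> R) :
  (forall t, 0 < m t) -> (forall t, 0 < u t) ->
  \sum_t m t = 1 -> \sum_t u t = 1 ->
  \sum_t m t * ln (m t / u t) <= 16^-1 -> dTV m u <= 4^-1.
Proof.
move=> m0 u0 m1 u1 kl.
(* With y and z the square roots of m t and u t, the first two terms dominate 4 (y - z)^2
   (Hellinger), and |y - z| (y + z) <= 4 (y - z)^2 + (y + z)^2 / 16 is AM-GM. Summation gives 4/16 +
   0 + 2/8 = 1/2. *)
have pt t : `|m t - u t| <=
    4 * (m t * ln (m t / u t)) + 4 * (u t - m t) + 8^-1 * (m t + u t).
  have [y y0 ym] : exists2 y, 0 < y & m t = y ^+ 2.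
    by exists (Num.sqrt (m t)); rewrite ?sqrtr_gt0 // sqr_sqrtr // ltW.
  have [z z0 zu] : exists2 z, 0 < z & u t = z ^+ 2.
    by exists (Num.sqrt (u t)); rewrite ?sqrtr_gt0 // sqr_sqrtr // ltW.
  rewrite ym zu.
  have h : 2 * (y ^+ 2 - y * z) <= y ^+ 2 * ln (y ^+ 2 / z ^+ 2).
    rewrite -expr_div_n lnXn ?divr_gt0 // -invf_div lnV ?posrE ?divr_gt0 //.
    have : ln (z / y) <= z / y - 1 by rewrite ln_le_subr1 // divr_gt0.
    move=> /(ler_wpM2l (ltW (exprn_gt0 2 y0))).
    have -> : y ^+ 2 * (z / y - 1) = y * z - y ^+ 2.
      by field; rewrite gt_eqF.
    have -> : y ^+ 2 * (- ln (z / y) *+ 2) = - (2 * (y ^+ 2 * ln (z / y))) by ring.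
    by move: (y ^+ 2 * ln _) => L; lra.
  have : 0 <= (y - z - 8^-1 * (y + z)) ^+ 2 by exact: sqr_ge0.
  have : 0 <= (y - z + 8^-1 * (y + z)) ^+ 2 by exact: sqr_ge0.
  have : 0 <= (y - z) ^+ 2 by exact: sqr_ge0.
  by case: (ger0P (y ^+ 2 - z ^+ 2)) => _; move: (_ * ln _) h => L h; nra.
have : \sum_t `|m t - u t| <= 2^-1.
  apply: (le_trans (ler_sum _ (fun t _ => pt t))).
  rewrite !big_split /= -!mulr_sumr sumrB big_split /= m1 u1; lra.
rewrite /dTV; lra.
Qed.

(** * The Potts measure and its conditional independence across the bipartition *)

Section PottsGraph.
Variables (R : realType) (V : finType) (e : rel V) (q : nat) (beta : R).
Hypothesis q_gt0 : (0 < q)%N.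
Local Notation config := {ffun V -> 'I_q}.
Implicit Types (s t u : config) (A B : {set V}) (v w : V).
Local Notation potts := (@potts R V e q beta).

Lemma agreeP A s t : reflect (forall v, v \in A -> t v = s v) (agree A s t).
Proof. exact: (iffP 'forall_in_eqP). Qed.

Lemma agree_equiv A : equivalence_rel (@agree V q A).
Proof.
move=> s t u; split; first exact/agreeP.
move=> /agreeP st; apply/agreeP/agreeP => h v vA; first by rewrite h // st.
by rewrite h // st.
Qed.

Lemma agree_sub A B : A \subset B -> subrel (@agree V q B) (@agree V q A).
Proof.
move=> AB s t /agreeP h; apply/agreeP => v vA.
by apply: h; apply: (fintype.subsetP AB).
Qed.

Lemma agreeU A B s t : agree (A :|: B)%SET s t = agree A s t && agree B s t.
Proof.
apply/agreeP/andP => [h|[/agreeP hA /agreeP hB] v].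
  by split; apply/agreeP => v vA; apply: h; rewrite inE vA ?orbT.
by rewrite inE => /orP[/hA|/hB].
Qed.

Lemma potts_weight_gt0 s : 0 < potts_weight e beta s.
Proof. exact: expR_gt0. Qed.

Lemma potts_Z_gt0 : 0 < potts_Z e q beta.
Proof.
rewrite /potts_Z (bigD1 [ffun=> Ordinal q_gt0]) //=.
by rewrite ltr_pwDl ?potts_weight_gt0 // sumr_ge0 // => s _; exact/ltW/potts_weight_gt0.
Qed.

Lemma potts_gt0 s : 0 < potts s.
Proof. by rewrite divr_gt0 ?potts_weight_gt0 ?potts_Z_gt0. Qed.

Lemma potts_sum1 : \sum_s potts s = 1.
Proof. by rewrite /Defs.potts -mulr_suml divff // gt_eqF // potts_Z_gt0. Qed.

Lemma bichromaticP s (x : {set V}) :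
  reflect (exists v w, [/\ x = [set v; w]%SET, e v w & s v != s w])
    (x \in bichromatic e s).
Proof.
apply: (iffP imsetP) => [[[v w]] /=|[v [w [-> evw svw]]]].
  by rewrite inE /= => /andP[evw svw] ->; exists v, w.
by exists (v, w); rewrite // inE evw.
Qed.

Lemma edgesP (x : {set V}) :
  reflect (exists v w, x = [set v; w]%SET /\ e v w) (x \in edges e).
Proof.
apply: (iffP imsetP) => [[[v w]] /=|[v [w [-> evw]]]].
  by rewrite inE /= => evw ->; exists v, w.
by exists (v, w); rewrite // inE.
Qed.

Lemma bichromatic_edges s : bichromatic e s \subset edges e.
Proof.
apply/fintype.subsetP => x /bichromaticP[v [w [-> evw _]]].
by apply/edgesP; exists v, w.
Qed.

Lemma bichromatic_agree (x : {set V}) s t : agree x s t ->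
  (x \in bichromatic e s) = (x \in bichromatic e t).
Proof.
move=> /agreeP h; apply/bichromaticP/bichromaticP => -[v [w [xE evw svw]]];
  exists v, w; split=> //; move: svw; rewrite !h // xE !inE eqxx ?orbT //.
Qed.

Definition set_spin s v (a : 'I_q) : config :=
  [ffun w => if w == v then a else s w].

Section ConditionalIndependence.
Variables E O : {set V}.
Hypothesis EO : [disjoint E & O].
Hypothesis edgeEO :
  forall v w, e v w -> (v \in E) && (w \in O) || (v \in O) && (w \in E).

Lemma odd_notin_even v : v \in O -> v \in E = false.
Proof. by move=> vO; apply/negbTE/negP => vE; move: EO => /pred0P/(_ v); rewrite /= vE vO. Qed.

Lemma edge_at (x : {set V}) v : x \in edges e -> v \in x -> v \in O ->
  x \subset (v |: E)%SET.
Proof.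
move=> /edgesP[y [z [-> /edgeEO h]]] vx vO; apply/fintype.subsetP => w.
move: vx h; rewrite !inE => /orP[]/eqP vE;
  rewrite -vE vO (odd_notin_even vO) /= ?andbF ?orbF ?andbT.
- by move=> zE /orP[/eqP ->|/eqP ->]; rewrite ?eqxx ?zE ?orbT.
- by move=> zE /orP[/eqP ->|/eqP ->]; rewrite ?eqxx ?zE ?orbT.
Qed.

(** An edge not containing v keeps its status, and an edge at v lies in [v |: E], where t and u
    agree. The sums stand for an equality of differences. *)
Lemma mem_bichromatic_set_spin (x : {set V}) v a t u :
  v \in O -> agree (v |: E)%SET t u ->
  ((x \in bichromatic e (set_spin u v a)) + (x \in bichromatic e t) =
   (x \in bichromatic e (set_spin t v a)) + (x \in bichromatic e u))%N.
Proof.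
move=> vO tu; have [vx|vx] := boolP (v \in x); last first.
  have H s : agree x (set_spin s v a) s.
    apply/agreeP => w wx; rewrite ffunE; case: eqP => // wv.
    by rewrite -wv wx in vx.
  by rewrite !(bichromatic_agree (H _)) addnC.
have [xe|xe] := boolP (x \in edges e); last first.
  by rewrite !(contraNF (fintype.subsetP (bichromatic_edges _) x) xe).
have xs := edge_at xe vx vO.
congr (nat_of_bool _ + nat_of_bool _)%N.
  apply/esym/bichromatic_agree; apply/agreeP => w wx; rewrite !ffunE.
  by case: eqP => // _; rewrite (agreeP _ _ _ tu) // (fintype.subsetP xs).
exact/bichromatic_agree/(agree_sub xs).
Qed.

(** The weight ratio for recoloring v depends only on the spins at v and on E: given the even spins,
    the odd spins are independent. *)
Lemma potts_set_spin v a t u : v \in O -> agree (v |: E)%SET t u ->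
  potts (set_spin u v a) * potts t = potts (set_spin t v a) * potts u.
Proof.
move=> vO tu; rewrite /Defs.potts !mulrA; congr (_ / _).
rewrite ![_ / _ * _]mulrAC; congr (_ / _); rewrite /potts_weight -!expRD -!mulrDr.
rewrite -!natrD; congr (expR (_ * _%:R)).
have cardE s : #|bichromatic e s| = (\sum_x (x \in bichromatic e s))%N.
  by rewrite -sum1_card big_mkcond; apply: eq_bigr => x _; case: (_ \in _).
rewrite !cardE -!big_split /=; apply: eq_bigr => x _.
exact: mem_bichromatic_set_spin.
Qed.

(** The last factor is the reciprocal of the conditional probability of the spin at v given the
    others; it is the same for every T. *)
Lemma potts_marg_set_spin (T : {set V}) v t : E \subset T -> v \in O -> v \notin T ->
  marg (agree T) potts t =
  marg (agree (v |: T)%SET) potts t * \sum_a potts (set_spin t v a) / potts t.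
Proof.
move=> ET vO vT; rewrite {1}/marg (partition_big (fun u => u v) xpredT) //=.
rewrite big_distrr /=; apply: eq_bigr => a _.
(* Configurations with spin a at v are matched with those having the spin of t there. *)
rewrite (reindex_onto (fun u => set_spin u v a) (fun u => set_spin u v (t v))) /=;
  last first.
  move=> u /andP[_ /eqP ua]; apply/ffunP => w; rewrite !ffunE.
  by case: eqP => // ->.
rewrite /marg mulr_suml; apply: eq_big => [u|u tu].
  rewrite !ffunE eqxx eqxx andbT agreeU.
  have -> : agree [set v]%SET t u = (set_spin (set_spin u v a) v (t v) == u).
    apply/agreeP/eqP => [h|h w].
      by apply/ffunP => w; rewrite !ffunE; case: eqP => // ->; rewrite h // inE.
    by rewrite inE => /eqP ->; rewrite -h !ffunE eqxx.
  rewrite andbC; congr (_ && _); apply/agreeP/agreeP => h w wT; have := h w wT;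
    by rewrite ffunE; case: eqP => // wv; rewrite -wv wT in vT.
have {}tu : agree (v |: E)%SET t u.
  have : set_spin (set_spin u v a) v (t v) = u by move: tu => /andP[_ /eqP].
  move: tu => /andP[/andP[/agreeP h _] _] h'; apply/agreeP => w.
  rewrite !inE => /orP[/eqP ->|wE]; first by rewrite -h' !ffunE eqxx.
  have wT := fintype.subsetP ET w wE.
  by have := h w wT; rewrite ffunE; case: eqP => // wv; rewrite -wv wT in vT.
have t0 : potts t != 0 by rewrite gt_eqF // potts_gt0.
by apply: (mulIf t0); rewrite -[RHS]mulrA divfK // potts_set_spin // mulrC.
Qed.

(** In the increment at v, mu contributes the average of [ln (rho t)] for A and for B alike, so it
    cancels; strong subadditivity for m remains. *)
Lemma KL_marg_supermodular (m : config -> R) (A B : {set V}) v : (forall s, 0 < m s) ->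
  A \subset B -> v \in O -> v \notin B ->
  KL_marg potts m (agree (E :|: (v |: A))%SET) - KL_marg potts m (agree (E :|: A)%SET) <=
  KL_marg potts m (agree (E :|: (v |: B))%SET) - KL_marg potts m (agree (E :|: B)%SET).
Proof.
move=> m0 AB vO vB.
have vA : v \notin A by apply: contra vB; apply: (fintype.subsetP AB).
set rho := fun t : config => \sum_a potts (set_spin t v a) / potts t.
have P (a : config -> R) T t : (forall s, 0 < a s) -> 0 < marg (@agree V q T) a t.
  by move=> *; apply/marg_gt0 => //; exact: agree_equiv.
have inc (T : {set V}) : v \notin T ->
    KL_marg potts m (agree (E :|: (v |: T))%SET) - KL_marg potts m (agree (E :|: T)%SET) =
    \sum_t m t * (ln (marg (agree (v |: (E :|: T))%SET) m t) + ln (rho t)) -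
    \sum_t m t * ln (marg (agree (E :|: T)%SET) m t).
  move=> vT; rewrite /KL_marg -!sumrB finset.setUCA; apply: eq_bigr => t _.
  have vET : v \notin (E :|: T)%SET by rewrite inE odd_notin_even.
  have := @potts_marg_set_spin (E :|: T)%SET v t (finset.subsetUl _ _) vO vET.
  rewrite -/(rho t) => mE.
  have rho0 : 0 < rho t.
    have := P _ (E :|: T)%SET t potts_gt0.
    by rewrite mE pmulr_rgt0 // P //; exact: potts_gt0.
  rewrite mE !ln_div ?posrE ?mulr_gt0 ?P //; try exact: potts_gt0.
  rewrite lnM ?posrE ?P //; last exact: potts_gt0.
  by ring.
rewrite !inc //.
have := @shannon_strong_subadditivity R _ (agree (E :|: A)%SET) (agree (v |: (E :|: A))%SET)
  (agree (E :|: B)%SET) (agree (v |: (E :|: B))%SET) m (@agree_equiv _)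
  (@agree_equiv _) (@agree_equiv _) (@agree_equiv _).
move=> /(_ (agree_sub (finset.subsetUr _ _)) (agree_sub (finset.setUS _ AB))).
move=> /(_ _ m0) ssa.
have {}ssa := ssa _; rewrite -!sumrB.
have : forall s t, agree (v |: (E :|: B))%SET s t =
    agree (v |: (E :|: A))%SET s t && agree (E :|: B)%SET s t.
  move=> s t; rewrite -agreeU -finset.setUA.
  by congr (agree (_ :|: _)%SET _ _); apply/esym/finset.setUidPr; apply: finset.setUS.
move=> /ssa; rewrite -subr_ge0 -sumrB => {}ssa.
rewrite -subr_ge0 -sumrB; apply: (le_trans ssa).
by apply: ler_sum => t _; rewrite le_eqVlt; apply/orP; left; apply/eqP; ring.
Qed.

End ConditionalIndependence.
End PottsGraph.

(** * Swendsen-Wang steps: independent percolation, recoloring, stationarity *)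

Section SWSteps.
Variables (R : realType) (V : finType) (e : rel V) (q : nat) (beta : R).
Hypothesis q_gt0 : (0 < q)%N.
Hypothesis beta_gt0 : 0 < beta.
Local Notation config := {ffun V -> 'I_q}.
Implicit Types (s t u : config) (A F W M : {set {set V}}) (v w : V).
Local Notation potts := (@potts R V e q beta).
Local Notation SW := (@SW R V e q beta).
Local Notation theta := (expR (- beta)).
Local Notation percolation := (@percolation R V beta).

Lemma theta_gt0 : 0 < theta. Proof. exact: expR_gt0. Qed.

Lemma theta_lt1 : theta < 1. Proof. by rewrite expR_lt1 oppr_lt0. Qed.

(** W ranges over sets of arbitrary subsets of V, so its law does not involve the graph; non-edges
    disappear on intersecting with [monochromatic e s]. *)
Definition bernoulli_set W : R := \prod_(x : {set V}) (if x \in W then 1 - theta else theta).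

Lemma bernoulli_set_gt0 W : 0 < bernoulli_set W.
Proof.
apply: prodr_gt0 => x _; case: ifP => _; last exact: theta_gt0.
by rewrite subr_gt0 theta_lt1.
Qed.

Lemma sum_bernoulli_set (f g : {set V} -> R) :
  \sum_(W : {set {set V}}) \prod_x (if x \in W then f x else g x) = \prod_x (f x + g x).
Proof. by rewrite bigA_distr. Qed.

Lemma bernoulli_set_sum1 : \sum_W bernoulli_set W = 1.
Proof. by rewrite sum_bernoulli_set big1 // => x _; rewrite subrK. Qed.

Lemma bernoulli_set_avoid F :
  \sum_(W : {set {set V}} | [disjoint W & F]) bernoulli_set W = theta ^+ #|F|.
Proof.
transitivity (\sum_(W : {set {set V}}) \prod_x
    (if x \in W then (if x \in F then 0 else 1 - theta) else theta)).
  rewrite big_mkcond; apply: eq_bigr => W _; case: ifPn => [WF|].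
    apply: eq_bigr => x _; case: ifP => // xW.
    by rewrite (disjointFr WF xW).
  by case/pred0Pn => x /andP[/= xW xF]; rewrite (bigD1 x) //= xW xF mul0r.
rewrite sum_bernoulli_set -prodr_const [RHS]big_mkcond; apply: eq_bigr => x _.
by case: ifP => _; rewrite ?add0r ?subrK.
Qed.

Lemma percolation_bernoulli M A :
  percolation M A = \sum_(W : {set {set V}} | (M :&: W)%SET == A) bernoulli_set W.
Proof.
rewrite /Defs.percolation; case: ifP => AM; last first.
  rewrite big_pred0 // => W; apply/negbTE/eqP => AE.
  by rewrite -AE finset.subsetIl in AM.
transitivity (\sum_(W : {set {set V}}) \prod_x
   (if x \in W then (if (x \in M) ==> (x \in A) then 1 - theta else 0)
    else (if (x \in M) ==> (x \notin A) then theta else 0))).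
  rewrite sum_bernoulli_set big_mkcond; apply: eq_bigr => x _.
  by case: (x \in M); case: (x \in A); rewrite /= ?addr0 ?add0r ?subrK.
rewrite [RHS]big_mkcond; apply: eq_bigr => W _; case: ifPn => [/eqP AE|].
  apply: eq_bigr => x _; rewrite -AE inE.
  by case: (x \in M); case: (x \in W).
move=> neA; have [x xP] : exists x, (x \in (M :&: W)%SET) != (x \in A).
  apply/existsP; apply: contraNT neA; rewrite negb_exists => /forallP h.
  by apply/eqP/setP => x; have := h x; rewrite negbK => /eqP.
rewrite (bigD1 x) //=; have := fintype.subsetP AM x; move: xP; rewrite inE.
by case: (x \in M); case: (x \in W); case: (x \in A) => //= _; rewrite ?mul0r // => /(_ isT).
Qed.

Lemma percolation_sum1 M : \sum_A percolation M A = 1.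
Proof.
rewrite -bernoulli_set_sum1 [RHS](partition_big (fun W => (M :&: W)%SET) xpredT) //=.
by apply: eq_bigr => A _; rewrite percolation_bernoulli.
Qed.

Lemma SW_bernoulli s t :
  SW s t = \sum_W bernoulli_set W *
     @recolor R V q (monochromatic e s :&: W)%SET t.
Proof.
rewrite [RHS](partition_big (fun W => (monochromatic e s :&: W)%SET) xpredT) //=.
apply: eq_bigr => A _; rewrite percolation_bernoulli mulr_suml.
by apply: eq_bigr => W /eqP ->.
Qed.

Definition linked A : rel V := connect [rel v w | [set v; w]%SET \in A].

Lemma linked_equiv A : equivalence_rel (linked A).
Proof.
have sy : connect_sym [rel v w | [set v; w]%SET \in A].
  by apply: sym_connect_sym => v w /=; rewrite finset.setUC.
move=> x y z; split; first exact: connect0.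
move=> xy; apply/idP/idP; last exact: connect_trans.
by rewrite /linked sy in xy; exact: connect_trans.
Qed.

Lemma components_partition A : finset.partition (components A) [set: V].
Proof. by apply: equivalence_partitionP => x y z _ _ _; exact: linked_equiv. Qed.

Lemma mem_component A v w :
  (w \in finset.pblock (components A) v) = linked A v w.
Proof.
by apply: (@pblock_equivalence_partition _ (linked A)); rewrite ?inE // => x y z _ _ _;
  exact: linked_equiv.
Qed.

Lemma component_in A v : finset.pblock (components A) v \in components A.
Proof.
apply: pblock_mem; have /and3P[/eqP -> _ _] := components_partition A.
by rewrite inE.
Qed.

Lemma component_pblock A (B : {set V}) v : B \in components A -> v \in B ->
  finset.pblock (components A) v = B.
Proof.
by move=> BA vB; apply: def_pblock => //; apply: (partition_trivIset (components_partition A)).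
Qed.

Lemma component_ex A (B : {set V}) : B \in components A -> exists v, v \in B.
Proof.
by move=> BA; apply/finset.set0Pn; apply: (partition_neq0 (components_partition A)).
Qed.

Lemma sub_monochromaticP A t : A \subset edges e ->
  reflect (forall v w, linked A v w -> t v = t w) (A \subset monochromatic e t).
Proof.
move=> Ae; apply: (iffP fintype.subsetP) => [AM v w|h x xA].
  suff : subrel (linked A) (fun x y => t x == t y) by move=> h /h/eqP.
  move=> x y /connectP[p pth ->]; elim: p x pth => //= z p IH x /andP[xz /IH].
  move=> /eqP <-; have := AM _ xz; rewrite inE => /andP[nb /edgesP[a [b [xzE eab]]]].
  apply: contraNT nb => txz; apply/bichromaticP; exists a, b; split=> //.
  apply: contra txz => /eqP tab.
  have : x \in [set a; b]%SET by rewrite -xzE !inE eqxx.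
  have : z \in [set a; b]%SET by rewrite -xzE !inE eqxx orbT.
  by rewrite !inE => /orP[]/eqP -> /orP[]/eqP ->; rewrite ?tab.
rewrite inE (fintype.subsetP Ae) // andbT; apply/bichromaticP => -[v [w [xE _]]].
by move/eqP; apply; apply: h; apply: connect1; rewrite /= -xE.
Qed.

(** Recoloring is uniform on the configurations constant on the components of A, which are those
    with A monochromatic. *)
Lemma recolorE A t : A \subset edges e ->
  @recolor R V q A t = (A \subset monochromatic e t)%:R / q%:R ^+ #|components A|.
Proof.
move=> Ae; rewrite /recolor big_split /= prodr_const exprVn; congr (_ * _).
have [h|h] := sub_monochromaticP t Ae.
  rewrite big1 // => B BA; have [v vB] := component_ex BA.
  have -> : [set a | [forall w in B, t w == a]]%SET = [set t v]%SET.
    apply/setP => a; rewrite !inE eq_sym; apply/forall_inP/eqP => [/(_ v vB)/eqP //|<- w wB].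
    by apply/eqP/esym/h; rewrite -mem_component (component_pblock BA vB).
  by rewrite cards1.
have [v [w [vw tvw]]] : exists v w, linked A v w /\ t v != t w.
  apply: contrapT => hn; apply: h => v w vw; apply: contrapT => /eqP tvw.
  by apply: hn; exists v, w.
rewrite (bigD1 (finset.pblock (components A) v)) ?component_in //= eq_card0 ?mul0r //.
move=> a; rewrite !inE; apply: contraNF tvw => /forall_inP ha.
have /eqP -> : t v == a by apply: ha; rewrite mem_component; exact: (linked_equiv A v v v).1.
by rewrite eq_sym; apply: ha; rewrite mem_component.
Qed.

Lemma card_monochromatic A : A \subset edges e ->
  #|[set t : config | A \subset monochromatic e t]%SET| = (q ^ #|components A|)%N.
Proof.
move=> Ae; pose y0 := Ordinal q_gt0.
(* Colorings of the components are coded as functions on all vertex sets with default value [y0]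
   elsewhere; [spread] is injective on these. *)
rewrite -[in RHS](card_ord q) -(card_pffun_on y0 (mem (components A)) predT).
pose spread (g : {ffun {set V} -> 'I_q}) : config :=
  [ffun v => g (finset.pblock (components A) v)].
rewrite -(@card_in_imset _ _ spread); last first.
  move=> g g' /pffun_onP[/supportP g0 _] /pffun_onP[/supportP g'0 _] gg'.
  apply/ffunP => B; have [BA|nBA] := boolP (B \in components A); last first.
    by rewrite g0 ?g'0.
  have [v vB] := component_ex BA.
  by have /ffunP/(_ v) := gg'; rewrite !ffunE (component_pblock BA vB).
apply: eq_card => t; rewrite inE; apply/(sub_monochromaticP t Ae)/imsetP => [h|].
  exists [ffun B => if B \in components A then
    (if [pick v in B] is Some v then t v else y0) else y0].
    apply/pffun_onP; split; last by move=> a _; rewrite inE.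
    by apply/supportP => B BA; rewrite ffunE (negbTE BA).
  apply/ffunP => v; rewrite !ffunE component_in; case: pickP => [w|/(_ v)] /=.
    by rewrite mem_component; exact: h.
  by rewrite mem_component (linked_equiv A v v v).1.
move=> [g _ ->] v w vw; rewrite !ffunE; congr (g _).
by apply/esym/component_pblock; rewrite ?component_in // mem_component.
Qed.

Lemma recolor_sum1 A : A \subset edges e -> \sum_t @recolor R V q A t = 1.
Proof.
move=> Ae; under eq_bigr => t _ do rewrite recolorE //.
rewrite -mulr_suml -natr_sum -big_mkcond sum1dep_card card_monochromatic //.
by rewrite natrX divff // expf_neq0 // pnatr_eq0 -lt0n.
Qed.

Lemma recolor_ge0 A t : 0 <= @recolor R V q A t.
Proof. by apply: prodr_ge0 => B _; rewrite divr_ge0. Qed.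

Lemma monochromatic_edges s : monochromatic e s \subset edges e.
Proof. exact: finset.subsetDl. Qed.

(** The Edwards-Sokal joint law: given A, the spins are uniform on the configurations compatible
    with A. *)
Lemma potts_percolation s A :
  potts s * percolation (monochromatic e s) A =
  (A \subset monochromatic e s)%:R *
    (\prod_(x in edges e) (if x \in A then 1 - theta else theta) / potts_Z e q beta).
Proof.
rewrite /Defs.percolation /Defs.potts; case: ifP => [AM|]; last by rewrite mulr0 mul0r.
rewrite mul1r mulrAC; congr (_ / _).
rewrite [RHS](big_setID (bichromatic e s)) /=; congr (_ * _).
rewrite (finset.setIidPr (bichromatic_edges e s)) /potts_weight expRM_natr -prodr_const.
apply: eq_bigr => x xD; case: ifP => // /(fintype.subsetP AM).
by rewrite inE xD.
Qed.

Lemma SW_stationary t : \sum_s potts s * SW s t = potts t.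
Proof.
transitivity (\sum_A \sum_s potts s * percolation (monochromatic e s) A * recolor R A t).
  rewrite exchange_big /=; apply: eq_bigr => s _; rewrite /Defs.SW mulr_sumr.
  by apply: eq_bigr => A _; rewrite mulrA.
(* The target is split over A as well. The identity then holds for each A, since recoloring
   resamples the spins from their law given A. *)
rewrite -[RHS]mulr1 -(percolation_sum1 (monochromatic e t)) mulr_sumr.
apply: eq_bigr => A _; rewrite -mulr_suml potts_percolation.
rewrite (eq_bigr _ (fun s _ => potts_percolation s A)).
have [Ae|nAe] := boolP (A \subset edges e); last first.
  have nM s : (A \subset monochromatic e s) = false.
    by apply: contraNF nAe => /fintype.subset_trans -> //; exact: monochromatic_edges.
  by rewrite nM mul0r big1 ?mul0r // => s _; rewrite nM mul0r.
rewrite -mulr_suml; move: (_ / potts_Z _ _ _) => c.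
rewrite recolorE //.
suff h : \sum_(s : config) (A \subset monochromatic e s)%:R = q%:R ^+ #|components A| :> R.
  rewrite h; have q0 : (q%:R : R) ^+ #|components A| != 0.
    by rewrite expf_neq0 // pnatr_eq0 -lt0n.
  by rewrite mulrC -mulrA; congr (_ * _); rewrite mulKf.
have := recolor_sum1 Ae; under eq_bigr => s _ do rewrite recolorE //.
rewrite -mulr_suml => /(congr1 (fun x => x * q%:R ^+ #|components A|)).
by rewrite divfK ?mul1r // expf_neq0 // pnatr_eq0 -lt0n.
Qed.

Lemma SW_sum1 s : \sum_t SW s t = 1.
Proof.
under eq_bigr => t _ do rewrite SW_bernoulli.
rewrite exchange_big /= -[RHS]bernoulli_set_sum1; apply: eq_bigr => W _.
rewrite -mulr_sumr recolor_sum1 ?mulr1 //.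
exact: fintype.subset_trans (finset.subsetIl _ _) (monochromatic_edges s).
Qed.

Lemma SW_gt0 s t : 0 < SW s t.
Proof.
rewrite SW_bernoulli (bigD1 finset.set0) //=; apply: ltr_pwDl.
  rewrite mulr_gt0 ?bernoulli_set_gt0 // finset.setI0 recolorE finset.sub0set //.
  by rewrite mul1r invr_gt0 exprn_gt0 // ltr0n.
by apply: sumr_ge0 => W _; rewrite mulr_ge0 ?recolor_ge0 // ltW // bernoulli_set_gt0.
Qed.

End SWSteps.

(** * Contraction of relative entropy *)

Section Contraction.
Variables (R : realType) (V : finType) (e : rel V) (q : nat) (beta : R).
Hypothesis q_gt0 : (0 < q)%N.
Hypothesis beta_gt0 : 0 < beta.
Hypothesis e_sym : symmetric e.
Variable Delta : nat.
Hypothesis degree : max_degree_le e Delta.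
Local Notation config := {ffun V -> 'I_q}.
Implicit Types (s t u : config) (F W : {set {set V}}) (A : {set V}) (v w : V).
Local Notation potts := (@potts R V e q beta).
Local Notation SW := (@SW R V e q beta).
Local Notation theta := (expR (- beta)).
Local Notation bernoulli_set := (@bernoulli_set R V beta).

Definition KL (m : config -> R) : R := \sum_t m t * ln (m t / potts t).

Lemma marg_full (m : config -> R) t : marg (agree [set: V]%SET) m t = m t.
Proof.
rewrite /marg (big_pred1 t) // => u; rewrite /= eq_sym.
apply/agreeP/eqP => [h|-> //]; apply/ffunP => v.
by apply/esym/h; rewrite inE.
Qed.

Lemma KL_full m : KL m = KL_marg potts m (agree [set: V]%SET).
Proof. by apply: eq_bigr => t _; rewrite !marg_full. Qed.

Definition touched (O : {set V}) W : {set V} :=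
  [set v in O | [exists w, e v w && ([set v; w]%SET \in W)]]%SET.

(** The vertex is untouched exactly when W avoids its at most Delta edges. *)
Lemma bernoulli_touched (O : {set V}) v : v \in O ->
  \sum_(W | v \in touched O W) bernoulli_set W <= 1 - theta ^+ Delta.
Proof.
move=> vO; pose F := [set [set v; w]%SET | w in [set w | e v w]%SET]%SET.
have <- : \sum_(W : {set {set V}} | ~~ [disjoint W & F]) bernoulli_set W =
    \sum_(W | v \in touched O W) bernoulli_set W.
  apply: eq_bigl => W; rewrite !inE vO /=; apply/pred0Pn/existsP.
    move=> [x /andP[/= xW /imsetP[w]]]; rewrite inE => vw xE.
    by exists w; rewrite vw -xE.
  move=> [w /andP[vw xW]]; exists [set v; w]%SET; rewrite /= xW /=.
  by apply/imsetP; exists w; rewrite ?inE.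
have := bernoulli_set_sum1 V beta; rewrite (bigID (fun W => [disjoint W & F])) /=.
rewrite bernoulli_set_avoid => h; rewrite -[leLHS](addKr (theta ^+ #|F|)) h addrC.
rewrite lerD2l lerN2; apply: ler_wiXn2l; first exact: expR_ge0.
  by rewrite expR_le1 oppr_le0 ltW.
by apply: leq_trans (degree v); apply: leq_imset_card.
Qed.

Section OneSide.
Variables E O : {set V}.
Hypothesis EO : [disjoint E & O].
Hypothesis edgeEO :
  forall v w, e v w -> (v \in E) && (w \in O) || (v \in O) && (w \in E).
Hypothesis EOV : (E :|: O)%SET = [set: V]%SET.

(** Both ends of an edge of W are in E or touched, so the spins there decide whether it is
    monochromatic. *)
Lemma monochromatic_touched W s t : agree (E :|: touched O W)%SET s t ->
  (monochromatic e s :&: W = monochromatic e t :&: W)%SET.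
Proof.
move=> st; apply/setP => x; rewrite !inE.
have [xe|] := boolP (x \in edges e); last by rewrite !andbF.
have [xW|] := boolP (x \in W); last by rewrite !andbF.
rewrite !andbT; congr (~~ _); apply: bichromatic_agree.
apply: agree_sub st; move: xe xW => /edgesP[v [w [-> vw]]] vwW.
have wv : e w v by rewrite e_sym.
apply/fintype.subsetP => y; rewrite !inE.
case/orP: (edgeEO vw) => /andP[a b] /orP[]/eqP ->; rewrite ?a ?b ?orbT //=.
  by apply/orP; right; apply/existsP; exists v; rewrite finset.setUC vwW wv.
by apply/orP; right; apply/existsP; exists w; rewrite vw.
Qed.

Lemma KL_step m : (forall s, 0 < m s) ->
  KL (fun t => \sum_s m s * SW s t) <=
  KL m - theta ^+ Delta * (KL m - KL_marg potts m (agree E)).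
Proof.
move=> m0; have u0 := potts_gt0 e beta q_gt0.
have := @mixture_dpi R _ _ bernoulli_set (fun W => agree (E :|: touched O W)%SET)
  (fun s W t => bernoulli_set W * @recolor R V q (monochromatic e s :&: W)%SET t)
  potts m (fun t => \sum_s m s * SW s t).
move=> /(_ (fun W => @agree_equiv _ _ _)) dpi.
apply: (le_trans (dpi _ _ _ m0 u0 _ _ _)) => {dpi}.
- by move=> s W t; rewrite mulr_ge0 ?recolor_ge0 // ltW // bernoulli_set_gt0.
- by move=> W t s s' ss'; rewrite (monochromatic_touched ss').
- move=> s W; rewrite -mulr_sumr (@recolor_sum1 R V e q q_gt0) ?mulr1 //.
  exact: fintype.subset_trans (finset.subsetIl _ _) (monochromatic_edges e s).
- move=> t; rewrite (bigD1 t) //= ltr_pwDl ?mulr_gt0 ?SW_gt0 //.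
  by apply: sumr_ge0 => s _; rewrite mulr_ge0 // ltW ?SW_gt0.
- by move=> t; apply: eq_bigr => s _; rewrite SW_bernoulli.
- move=> t; rewrite -[LHS](SW_stationary e beta q_gt0).
  by apply: eq_bigr => s _; rewrite SW_bernoulli.
(* Here h at the empty set is the relative entropy on E, and h at O is the full one. *)
have := @supermodular_average R _ _ bernoulli_set (touched O)
  (fun A => KL_marg potts m (agree (E :|: A)%SET)) (1 - theta ^+ Delta) O.
rewrite finset.setU0 EOV -KL_full => sup.
have {}sup := sup (fun W => ltW (bernoulli_set_gt0 beta_gt0 W)) (bernoulli_set_sum1 V beta)
  (@bernoulli_touched O).
rewrite (eq_bigr (fun W => bernoulli_set W *
   KL_marg potts m (agree (E :|: touched O W :&: O)%SET))); last first.
  move=> W _; congr (_ * KL_marg _ _ (agree (_ :|: _)%SET)).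
  by apply/esym/finset.setIidPl/fintype.subsetP => v; rewrite inE => /andP[].
apply: (le_trans (sup _ _)).
- move=> A v _; apply: KL_marg_mono => //; try exact: agree_equiv.
  by apply: agree_sub; apply: finset.setUS; apply: finset.subsetUr.
- by move=> A B v; exact: (KL_marg_supermodular beta q_gt0 EO edgeEO m0).
by rewrite le_eqVlt; apply/orP; left; apply/eqP; ring.
Qed.

End OneSide.

Section Entropy.
Variable m : config -> R.
Hypothesis m_gt0 : forall s, 0 < m s.
Hypothesis m_sum1 : \sum_s m s = 1.
Local Notation f := (fun s => m s / potts s).

Lemma expect_density : expect potts f = 1.
Proof.
rewrite -m_sum1; apply: eq_bigr => s _; rewrite mulrC divfK //.
by rewrite gt_eqF // potts_gt0.
Qed.

Lemma Ent_density : Ent potts f = KL m.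
Proof.
rewrite /Ent expect_density; apply: eq_bigr => s _.
by rewrite divr1 mulrA [potts s * _]mulrC divfK // gt_eqF // potts_gt0.
Qed.

(** Chain rule: the mean conditional entropy of the density is what the full relative entropy adds
    to that of the spins on A. *)
Lemma Ent_cond_density (A : {set V}) :
  expect potts (fun s => Ent (potts_cond e beta A s) f) =
  KL m - KL_marg potts m (agree A).
Proof.
have u0 := potts_gt0 e beta q_gt0.
have P (a : config -> R) t : (forall s, 0 < a s) -> 0 < marg (agree A) a t.
  by move=> ?; apply: marg_gt0 => //; exact: agree_equiv.
have EntE s : Ent (potts_cond e beta A s) f =
   marg (agree A) (fun t => m t * (ln (m t / potts t) -
     ln (marg (agree A) m t / marg (agree A) potts t))) s / marg (agree A) potts s.
  rewrite /Ent.
  have -> : expect (potts_cond e beta A s) f = marg (agree A) m s / marg (agree A) potts s.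
    rewrite /expect /marg mulr_suml [RHS]big_mkcond; apply: eq_bigr => t _.
    rewrite /potts_cond; case: ifP => _; rewrite ?mul0r // -/(marg _ _ _).
    by field; rewrite !gt_eqF // P.
  rewrite /expect [marg _ (fun _ => _) _]/marg [RHS]mulr_suml [RHS]big_mkcond.
  apply: eq_bigr => t _.
  rewrite /potts_cond; case: ifP => [st|_]; rewrite ?mul0r // -!/(marg _ _ _).
  rewrite !(@marg_equiv _ _ _ _ s t) //; try exact: agree_equiv.
  have -> : ln (m t / potts t / (marg (agree A) m t / marg (agree A) potts t)) =
      ln (m t / potts t) - ln (marg (agree A) m t / marg (agree A) potts t).
    by rewrite [LHS]ln_div // posrE divr_gt0 ?P.
  have ut : potts t != 0 by rewrite gt_eqF.
  by rewrite -[RHS]mulrA [LHS]mulrA [potts t / _ * _]mulrA; field; rewrite ut gt_eqF // P.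
under [LHS]eq_bigr => s _ do rewrite EntE -[_ * _]mulr1.
rewrite sum_marg_exchange //; last exact: agree_equiv.
rewrite /KL /KL_marg -sumrB; apply: eq_bigr => t _; ring.
Qed.

End Entropy.

Lemma KL_contraction (E O : {set V}) (C : R) m : bipartition e E O ->
  even_odd_factorization e q beta E O C ->
  (forall s, 0 < m s) -> \sum_s m s = 1 ->
  KL (fun t => \sum_s m s * SW s t) <=
  (1 - theta ^+ Delta / (2 * Num.max C 1)) * KL m.
Proof.
move=> [EOV EO edgeEO] fac m0 m1; have u0 := potts_gt0 e beta q_gt0.
have := fac (fun s => m s / potts s) (fun s => divr_ge0 (ltW (m0 s)) (ltW (u0 s))).
rewrite Ent_density // !Ent_cond_density // => {}fac.
have h1 := KL_step EO edgeEO EOV m0.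
have OE : [disjoint O & E] by rewrite disjoint_sym.
have OEV : (O :|: E = [set: V])%SET by rewrite finset.setUC.
have edgeOE v w : e v w -> (v \in O) && (w \in E) || (v \in E) && (w \in O).
  by move=> /edgeEO; rewrite orbC.
have h2 := KL_step OE edgeOE OEV m0.
have mono (A : {set V}) : 0 <= KL m - KL_marg potts m (agree A).
  rewrite subr_ge0 KL_full; apply: KL_marg_mono => //; try exact: agree_equiv.
  exact/agree_sub/finset.subsetT.
move: (mono E) (mono O) h1 h2 fac.
move: (KL m - KL_marg _ _ (agree E)) (KL m - KL_marg _ _ (agree O)) => a b a0 b0 h1 h2 fac.
(* The maximum makes division legitimate for every real C and keeps the contraction factor
   nonnegative. Half the sum of [h1] and [h2] then gives the claim. *)
set C' := Num.max C 1; have C'1 : 1 <= C' by rewrite /C' le_max lexx orbT.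
have C'0 : 0 < C' by lra.
have facC' : KL m / C' <= a + b.
  rewrite ler_pdivrMr // mulrC (le_trans fac) // ler_wpM2r ?addr_ge0 //.
  by rewrite /C' le_max lexx.
have t0 : 0 <= theta ^+ Delta by rewrite exprn_ge0 // expR_ge0.
have -> : theta ^+ Delta / (2 * C') = theta ^+ Delta / C' / 2 by field; rewrite gt_eqF.
have := ler_wpM2l t0 facC'; rewrite mulrA [_ * KL m / _]mulrAC.
by move: (theta ^+ Delta / C') => d; move: (theta ^+ Delta) h1 h2 => th; lra.
Qed.

(** * Iteration from a point mass *)

(** The exponent starts at 1 because the initial point mass is not a positive law. *)
Lemma kernel_pow_SW (x : config) (t : nat) : (forall y, 0 < kernel_pow SW t.+1 x y) /\
  \sum_y kernel_pow SW t.+1 x y = 1.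
Proof.
elim: t => [|t [IH0 IH1]].
  have SWE y : kernel_pow SW 1 x y = SW x y.
    rewrite /= (bigD1 x) //= eqxx mul1r big1 ?addr0 // => z.
    by rewrite eq_sym => /negbTE ->; rewrite mul0r.
  split=> [y|]; first by rewrite SWE SW_gt0.
  by under eq_bigr do rewrite SWE; rewrite SW_sum1.
split=> [y|].
  have -> : kernel_pow SW t.+2 x y = \sum_(z : config) kernel_pow SW t.+1 x z * SW z y by [].
  rewrite (bigD1 y) //; apply: ltr_pwDl; first by rewrite mulr_gt0 ?SW_gt0.
  by apply: sumr_ge0 => z _; apply: mulr_ge0; apply: ltW; rewrite ?SW_gt0.
rewrite exchange_big /= -[RHS]IH1; apply: eq_bigr => z _.
by rewrite -mulr_sumr SW_sum1 ?mulr1.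
Qed.

Lemma card_edges_le : (#|edges e| <= #|V| * Delta)%N.
Proof.
apply: (leq_trans (leq_imset_card _ _)).
rewrite -sum1_card (eq_bigl (fun p : V * V => e p.1 p.2)); last by move=> p; rewrite !inE.
rewrite -(pair_big_dep xpredT e (fun _ _ => 1%N)) /= -sum_nat_const.
by apply: leq_sum => v _; rewrite sum1dep_card; apply: degree.
Qed.

(** At most n Delta edges are bichromatic, and the partition function is at most q^n. *)
Lemma potts_ge s : - (#|V|%:R * (beta * Delta%:R + ln q%:R)) <= ln (potts s).
Proof.
have q0 : 0 < q%:R :> R by rewrite ltr0n.
have Z0 := potts_Z_gt0 e beta q_gt0.
rewrite /Defs.potts ln_div ?posrE ?potts_weight_gt0 // /potts_weight expRK.
have h1 : #|bichromatic e s|%:R <= (#|V|%:R * Delta%:R : R).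
  by rewrite -natrM ler_nat (leq_trans (subset_leq_card (bichromatic_edges e s))) // card_edges_le.
have h2 : ln (potts_Z e q beta) <= #|V|%:R * ln q%:R.
  rewrite mulr_natl -lnXn // ler_ln ?posrE ?exprn_gt0 //.
  rewrite -natrX -{2}(card_ord q) -card_ffun -sum1_card natr_sum.
  apply: ler_sum => t _; rewrite /potts_weight expR_le1 mulNr oppr_le0.
  by rewrite mulr_ge0 // ltW.
have := ler_wpM2l (ltW beta_gt0) h1; lra.
Qed.

Lemma KL_le m : (forall s, 0 < m s) -> \sum_s m s = 1 ->
  KL m <= #|V|%:R * (beta * Delta%:R + ln q%:R).
Proof.
move=> m0 m1; have := potts_ge; move: (#|V|%:R * _) => c pc.
rewrite -[c]mul1r -m1 mulr_suml; apply: ler_sum => t _.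
apply: ler_wpM2l; first exact/ltW.
rewrite ln_div ?posrE ?potts_gt0 //.
have mt1 : m t <= 1.
  by rewrite -m1 (bigD1 t) //= lerDl sumr_ge0 // => s _; rewrite ltW.
by have := pc t; have := ln_le0 mt1; lra.
Qed.

Lemma KL_kernel_pow (E O : {set V}) (C : R) (x : config) (t : nat) : bipartition e E O ->
  even_odd_factorization e q beta E O C ->
  KL (kernel_pow SW t.+1 x) <= (1 - theta ^+ Delta / (2 * Num.max C 1)) ^+ t *
    (#|V|%:R * (beta * Delta%:R + ln q%:R)).
Proof.
move=> bip fac; elim: t => [|t IH].
  by rewrite expr0 mul1r; apply: KL_le; have [] := kernel_pow_SW x 0.
have [p0 p1] := kernel_pow_SW x t.
apply: (le_trans (KL_contraction bip fac p0 p1)).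
rewrite exprS -mulrA ler_wpM2l // subr_ge0.
have C1 : 1 <= Num.max C 1 by rewrite le_max lexx orbT.
rewrite ler_pdivrMr ?mul1r; last lra.
apply: (@le_trans _ _ 1); last lra.
by rewrite exprn_ile1 ?expR_ge0 // expR_le1 oppr_le0 ltW.
Qed.

End Contraction.

Theorem theorem1p5 (R : realType) (q : nat) (beta : R)
    (hq : (2 <= q)%N) (hbeta : 0 < beta) (Delta : nat) (C : R) :
  exists K : R,
    forall (V : finType) (e : rel V) (E O : {set V}),
      simple_graph e ->
      bipartition e E O ->
      max_degree_le e Delta ->
      (2 <= #|V|)%N ->
      even_odd_factorization e q beta E O C ->
      (Tmix (SW e q beta) (potts e q beta) <= (K * ln #|V|%:R)%:E)%E.
Proof.
have q0 : (0 < q)%N by exact: ltnW.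
pose d : R := expR (- beta) ^+ Delta / (2 * Num.max C 1).
have C1 : 1 <= Num.max C 1 by rewrite le_max lexx orbT.
have d0 : 0 < d by rewrite divr_gt0 ?exprn_gt0 ?expR_gt0 //; lra.
have d1 : d <= 1.
  rewrite /d ler_pdivrMr ?mul1r; last lra.
  apply: (@le_trans _ _ 1); last lra.
  by rewrite exprn_ile1 ?expR_ge0 // expR_le1 oppr_le0 ltW.
pose c : R := beta * Delta%:R + ln q%:R.
have c0 : 0 <= c by apply: addr_ge0; [rewrite mulr_ge0 // ltW | rewrite ln_ge0 // ler1n].
have ln2 : 0 < ln 2 :> R by rewrite ln_gt0 // ltr1n.
pose L : R := ln (16 * c + 1).
have L0 : 0 <= L by apply: ln_ge0; lra.
(* The time used is at most (ln n + L) / d + 2; its constant part is absorbed through ln n >= ln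
   2. *)
exists (d^-1 + (L / d + 2) / ln 2) => V e E O [e_sym _] bip deg n2 fac.
set n : R := #|V|%:R; have n0 : 0 < n by rewrite ltr0n ltnW.
have lnn : ln 2 <= ln n by rewrite ler_ln ?posrE // ler_nat.
pose a := (ln n + L) / d.
have a0 : 0 <= a by apply: divr_ge0; lra.
pose t := (Num.truncn a).+1.
have [ta at1] : t%:R <= a + 1 /\ a <= t%:R.
  by have /andP[h1 h2] := truncn_itv a0; split; [rewrite -natr1 lerD2r | exact: ltW].
apply: bigmax_le => [|x _]; first exact: leNye.
apply: ge_ereal_inf; exists (t.+1%:R%:E); last first.
  rewrite lee_fin -natr1.
  have : (L / d + 2) <= (L / d + 2) / ln 2 * ln n.
    have LD0 : 0 <= L / d by rewrite divr_ge0 // ltW.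
    by rewrite -mulrA ler_peMr ?addr_ge0 // mulrC ler_pdivlMr // mul1r.
  have : a = d^-1 * ln n + L / d by rewrite /a mulrDl mulrC.
  by rewrite mulrDl; lra.
exists t.+1 => //=.
have [p0 p1] := kernel_pow_SW e q0 hbeta x t.
apply: kl_dTV => //; [exact: potts_gt0 | exact: potts_sum1 |].
apply: (le_trans (KL_kernel_pow q0 hbeta e_sym deg x t bip fac)).
rewrite -/d -/n -/c.
apply: (@le_trans _ _ (expR (- (ln n + L)) * (n * c))).
  apply: ler_wpM2r; first by rewrite mulr_ge0 // ltW.
  (* 1 - d <= exp(-d), and d t >= ln n + L by the choice of t. *)
  apply: (@le_trans _ _ (expR (- d) ^+ t)).
    rewrite lerXn2r ?nnegrE ?expR_ge0 ?subr_ge0 //.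
    exact: expR_ge1Dx.
  rewrite -expRM_natr ler_expR mulNr lerN2 mulrC.
  by rewrite -ler_pdivrMr.
rewrite opprD expRD !expRN lnK ?posrE // /L lnK ?posrE; last lra.
rewrite mulrACA mulVf ?gt_eqF // mul1r mulrC ler_pdivrMr; lra.
Qed.
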